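(* Let a Boolean control network $x(t+1)=Lu(t)x(t)$, $y(t)=Hx(t)$ be given, with weighted pair graph $\mathcal{G}=(\mathcal{V},\mathcal{E},\mathcal{W})$. The network is not Type-4 observable if and only if there is a non-diagonal vertex $(\delta_N^i,\delta_N^j)$ of $\mathcal{G}$ such that the transition graph of the deterministic finite automaton $A_{(\delta_N^i,\delta_N^j)}$ has a cycle.
   Context: Fix positive integers $n,m,q$ and put $N=2^n$, $M=2^m$, $Q=2^q$. For a positive integer $k$, $\delta_k^i$ is the $i$-th column of the identity matrix $I_k$ and $\Delta_k=\{\delta_k^1,\dots,\delta_k^k\}$. A logical matrix of size $k\times s$ is one all of whose columns lie in $\Delta_k$. A Boolean control network (BCN, in algebraic form) is a system $x(t+1)=Lu(t)x(t)$, $y(t)=Hx(t)$, $t=0,1,2,\dots$, with states $x(t)\in\Delta_N$, inputs $u(t)\in\Delta_M$, outputs $y(t)\in\Delta_Q$, where $L$ is an $N\times NM$ logical matrix and $H$ is a $Q\times N$ logical matrix. Products are semi-tensor products; concretely $Lux=L(u\otimes x)$ for $u\in\Delta_M$, $x\in\Delta_N$, with $\otimes$ the Kronecker product. For $x_0\in\Delta_N$ and an infinite input sequence $U=u_0u_1\cdots\in(\Delta_M)^{\mathbb{N}}$, put $x_{t+1}=Lu_tx_t$ for $t\ge0$ and $(HL)_{x_0}^{\mathbb{N}}(U)=(Hx_1)(Hx_2)\cdots\in(\Delta_Q)^{\mathbb{N}}$. Type-4 observability: for any distinct $x_0,\bar x_0\in\Delta_N$ and any $U\in(\Delta_M)^{\mathbb{N}}$,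 $Hx_0=H\bar x_0$ implies $(HL)_{x_0}^{\mathbb{N}}(U)\neq(HL)_{\bar x_0}^{\mathbb{N}}(U)$. Weighted pair graph $\mathcal{G}=(\mathcal{V},\mathcal{E},\mathcal{W})$: $\mathcal{V}$ is the set of unordered pairs $(x,x')$ (so $(x,x')=(x',x)$, and $x=x'$ is allowed) of elements of $\Delta_N$ with $Hx=Hx'$. For vertices $v=(x_1,x_1')$, $w=(x_2,x_2')$, let $\mathcal{W}((v,w))$ be the set of $u\in\Delta_M$ such that ($Lux_1=x_2$ and $Lux_1'=x_2'$) or ($Lux_1=x_2'$ and $Lux_1'=x_2$). The directed edge $(v,w)$ belongs to $\mathcal{E}$ iff this set is nonempty, and then it is the weight of the edge. A vertex $(x,x)$ is called diagonal; the other vertices are non-diagonal. The deterministic finite automaton $A_{(\delta_N^i,\delta_N^j)}$ (with a possibly partial transition function), for a non-diagonal vertex $(\delta_N^i,\delta_N^j)$: its alphabet is $\Delta_M$; its initial state is the vertex $(\delta_N^i,\delta_N^j)$; its states are this vertex together with all vertices $v\in\mathcal{V}$ reachable from it by a directed path in $\mathcal{G}$; the transition function at $(v,u)$ has value $w$ iff $(v,w)\in\mathcal{E}$ and $u\in\mathcal{W}((v,w))$, and is undefined at $(v,u)$ if no such $w$ exists. All states are final. Its transition graph is the directed graph whose vertices are its states and which has an edge from $v$ to $w$ iff some letter takes $v$ to $w$; that is, the subgraph of $\mathcal{G}$ induced on these vertices. Cycles are directed, and a self-loop counts as a cycle. *)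

(* Defs.v *)
From mathcomp Require Import all_boot all_order all_algebra.
From mathcomp.real_closed Require Export mxtens.

Set Implicit Arguments.
Unset Strict Implicit.
Unset Printing Implicit Defensive.

Local Open Scope ring_scope.

Section Logical.
Variable R : realFieldType.

Definition deltas (k : nat) : seq 'cV[R]_k :=
  [seq col i (1%:M : 'M[R]_k) | i : 'I_k].

(* Delta_k as the finite type of those column vectors that are columns of I_k;
   [val] recovers the vector. *)
Definition Delta (k : nat) : Type := seq_sub (deltas k).

Definition logical (k s : nat) (A : 'M[R]_(k, s)) : Prop :=
  forall j, col j A \in deltas k.

End Logical.

Section Network.
Variables (R : realFieldType) (N M Q : nat).
(* The width of L is written M * N rather than N * M, as this is literally the
   height of the Kronecker product u *t x. *)
Variables (L : 'M[R]_(N, M * N)) (H : 'M[R]_(Q, N)).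

Definition next_state (u : 'cV[R]_M) (x : 'cV[R]_N) : 'cV[R]_N := L *m (u *t x).

Fixpoint state_at (x0 : 'cV[R]_N) (U : nat -> Delta R M) (t : nat) : 'cV[R]_N :=
  if t is t'.+1 then next_state (val (U t')) (state_at x0 U t') else x0.

(* The t-th letter is H x_(t+1): the initial output H x_0 is not recorded. *)
Definition outputs (x0 : 'cV[R]_N) (U : nat -> Delta R M) : nat -> 'cV[R]_Q :=
  fun t => H *m state_at x0 U t.+1.

Definition type4_observable : Prop :=
  forall (x0 x0' : Delta R N) (U : nat -> Delta R M),
    x0 <> x0' -> H *m val x0 = H *m val x0' ->
    outputs (val x0) U <> outputs (val x0') U.

(* The unordered pair (x, x') is the set {x, x'}, a singleton when x = x'. *)
Definition upair (x x' : Delta R N) : {set Delta R N} := [set x; x'].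

Definition is_vertex (v : {set Delta R N}) : bool :=
  [exists x, exists x', (v == upair x x') && (H *m val x == H *m val x')].

Definition vertex : Type := {v : {set Delta R N} | is_vertex v}.

Definition diagonal (v : vertex) : bool := [exists x, val v == upair x x].

Definition drives (u : Delta R M) (x1 x1' x2 x2' : Delta R N) : bool :=
  (next_state (val u) (val x1) == val x2) && (next_state (val u) (val x1') == val x2')
  || (next_state (val u) (val x1) == val x2') && (next_state (val u) (val x1') == val x2).

(* [weightE] below: the choice of representatives is immaterial. *)
Definition weight (v w : vertex) : {set Delta R M} :=
  [set u | [exists x1, exists x1', exists x2, exists x2',
     [&& val v == upair x1 x1', val w == upair x2 x2' & drives u x1 x1' x2 x2']]].

Lemma upair_img (x y x' y' : Delta R N) :
  upair x y = upair x' y' -> (x = x' /\ y = y') \/ (x = y' /\ y = x').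
Proof.
move=> e.
have /set2P ex : x \in upair x' y' by rewrite -e set21.
have /set2P ey : y \in upair x' y' by rewrite -e set22.
have /set2P ex' : x' \in upair x y by rewrite e set21.
have /set2P ey' : y' \in upair x y by rewrite e set22.
by case: ex ey ex' ey' => ? [] ? [] ? [] ?; subst; auto.
Qed.

Lemma weightE (v w : vertex) (u : Delta R M) x1 x1' x2 x2' :
  val v = upair x1 x1' -> val w = upair x2 x2' ->
  (u \in weight v w) = drives u x1 x1' x2 x2'.
Proof.
move=> ev ew; rewrite inE; apply/idP/idP; last first.
  move=> d; apply/existsP; exists x1; apply/existsP; exists x1'.
  by apply/existsP; exists x2; apply/existsP; exists x2'; rewrite ev ew !eqxx.
move=> /existsP[y1] /existsP[y1'] /existsP[y2] /existsP[y2'].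
rewrite ev ew => /and3P[/eqP/upair_img e1 /eqP/upair_img e2].
case: e1 => -[? ?]; case: e2 => -[? ?]; subst; rewrite /drives //.
- by rewrite orbC.
- by rewrite orbC andbC [X in _ || X]andbC.
- by rewrite andbC [X in _ || X]andbC.
Qed.

Definition edge : rel vertex := [rel v w | weight v w != set0].

End Network.

(* Deterministic finite automata with a partial transition function. *)
Record pdfa (A : finType) := PDfa {
  dfa_state : finType;
  dfa_init : dfa_state;
  dfa_final : {set dfa_state};
  dfa_trans : dfa_state -> A -> option dfa_state }.

Arguments dfa_trans {A} D v a : rename.

Definition transition_graph (A : finType) (D : pdfa A) : rel (dfa_state D) :=
  [rel v w | [exists a, dfa_trans D v a == Some w]].

Arguments transition_graph {A} D.

(* [ucycle e c] also holds of the empty sequence, hence the first conjunct;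
   [:: v] is a cycle iff v has a self-loop. *)
Definition has_cycle (T : eqType) (e : rel T) : Prop :=
  exists c : seq T, c != [::] /\ ucycle e c.

Section Automaton.
Variables (R : realFieldType) (N M Q : nat).
Variables (L : 'M[R]_(N, M * N)) (H : 'M[R]_(Q, N)).

(* [connect] is reflexive, so v0 itself is a state. *)
Definition reachable (v0 : vertex H) : Type :=
  {v : vertex H | connect (edge L (H := H)) v0 v}.

Definition init_state (v0 : vertex H) : reachable v0 :=
  exist _ v0 (connect0 (edge L (H := H)) v0).

(* There is at most one such w: see [transP] below. *)
Definition trans (v0 : vertex H) (v : reachable v0) (u : Delta R M) :
    option (reachable v0) :=
  [pick w : reachable v0 |
     edge L (val v) (val w) && (u \in weight L (val v) (val w))].

Lemma vertexP (v : vertex H) : exists x x', val v = upair x x'.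
Proof.
by case/existsP: (valP v) => x /existsP[x' /andP[/eqP e _]]; exists x, x'.
Qed.

Lemma weight_inj (v w w' : vertex H) (u : Delta R M) :
  u \in weight L v w -> u \in weight L v w' -> w = w'.
Proof.
have [x [x' ev]] := vertexP v; have [y [y' ew]] := vertexP w.
have [z [z' ew']] := vertexP w'.
rewrite (weightE L u ev ew) (weightE L u ev ew') /drives => h h'.
apply: val_inj; rewrite ew ew'.
by case/orP: h => /andP[/eqP h1 /eqP h2]; case/orP: h' => /andP[];
  rewrite h1 h2 => /eqP/val_inj-> /eqP/val_inj->; rewrite // /upair setUC.
Qed.

Lemma transP (v0 : vertex H) (v w : reachable v0) (u : Delta R M) :
  trans v u = Some w <->
  edge L (val v) (val w) /\ u \in weight L (val v) (val w).
Proof.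
rewrite /trans; case: pickP => [w' /andP[ew' uw'] | none]; split.
- by case=> <-.
- by case=> ew uw; congr Some; apply/val_inj/(weight_inj uw' uw).
- by [].
- by case=> ew uw; have := none w; rewrite ew uw.
Qed.

Definition automaton (v0 : vertex H) : pdfa (Delta R M) :=
  PDfa (init_state v0) setT (@trans v0).

End Automaton.

(* Main.v *)
Require Import Defs.
From mathcomp Require Import all_boot all_order all_algebra.
From Stdlib Require Import Classical_Prop FunctionalExtensionality.
Local Open Scope ring_scope.

(** Both sides of the equivalence say that some non-diagonal vertex starts an
    infinite walk in the weighted pair graph.

    - A failure of Type-4 observability is a pair of distinct states and an input
      sequence whose two trajectories always have equal outputs. The pairs of
      simultaneous states are then vertices, and they form an infinite walk
      ([not_observable_walk]). Conversely, choosing a letter on each edge of an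
      infinite walk gives an input sequence. As the network is deterministic,
      the two trajectories from the initial pair must follow the walk
      ([weight_step]), and the outputs agree because every vertex consists of
      states with equal outputs ([walk_not_observable]).

    - An infinite walk stays among the finitely many states of the automaton,
      so it revisits one of them and closes a cycle ([walk_has_cycle]).
      Conversely, a cycle is reachable from the initial state, so one can walk
      to it and then go round it for ever ([reachable_cycle_walk]). *)

Definition infinite_walk (T : Type) (e : rel T) (f : nat -> T) : Prop :=
  forall t, e (f t) (f t.+1).

Lemma infinite_walk_connect (T : finType) (e : rel T) (f : nat -> T) i j :
  infinite_walk T e f -> (i <= j)%N -> connect e (f i) (f j).
Proof.
move=> ef /subnKC <-; elim: (j - i)%N => [|k IHk]; first by rewrite addn0.
by rewrite addnS; apply: connect_trans IHk (connect1 (ef _)).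
Qed.

(** By pigeonhole the walk repeats a vertex; a loop-free path from just after
    the first visit to the second one closes up to a simple cycle. *)
Lemma walk_has_cycle (T : finType) (e : rel T) (f : nat -> T) :
  infinite_walk T e f -> has_cycle e.
Proof.
move=> ef.
have [i [j [lt_ij eq_f]]] : exists i j, (i < j)%N /\ f i = f j.
  have /injectivePn[i [j ne_ij eq_f]] :
      ~~ injectiveb (fun i : 'I_#|T|.+1 => f i).
    by apply/injectiveP => /leq_card; rewrite card_ord ltnn.
  have [lt_ij | lt_ji | /val_inj eq_ij] := ltngtP i j.
  - by exists i, j.
  - by exists j, i.
  - by rewrite eq_ij eqxx in ne_ij.
have /connectP[p ep lp] := infinite_walk_connect T e f _ _ ef lt_ij.
case/shortenP: ep lp => p' ep' up' _ lp'.
exists (f i.+1 :: p'); split=> //; apply/andP; split=> //.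
by rewrite /= rcons_path ep' -lp' -eq_f ef.
Qed.

(** Being able to reach the cycle is a property that some successor always
    inherits, be it the next vertex on a path to the cycle or the next vertex
    of the cycle itself; iterating the choice of such a successor gives the
    walk. *)
Lemma reachable_cycle_walk (T : finType) (e : rel T) (c : seq T) (x z : T) :
  cycle e c -> z \in c -> connect e x z ->
  exists2 f, f 0%N = x & infinite_walk T e f.
Proof.
move=> ec zc xz.
pose P y := [exists z in c, connect e y z].
pose succ y := odflt y [pick w | e y w && P w].
have succP y : P y -> e y (succ y) && P (succ y).
  case/existsP=> z' /andP[z'c yz']; rewrite /succ; case: pickP => //= none.
  case/connectP: yz' => -[|w p] /=.
    move=> _ eq_z'; rewrite eq_z' in z'c.
    have /negP[] := negbT (none (next c y)); rewrite next_cycle //=.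
    by apply/existsP; exists (next c y); rewrite mem_next z'c connect0.
  case/andP=> yw wp eq_z'; have /negP[] := negbT (none w); rewrite yw /=.
  by apply/existsP; exists z'; rewrite z'c; apply/connectP; exists p.
have Pf t : P (iter t succ x).
  elim: t => [|t /succP/andP[] //]; first by apply/existsP; exists z; rewrite zc.
by exists (fun t => iter t succ x) => // t; case/andP: (succP _ (Pf t)).
Qed.

Section Network.
Variables (R : realFieldType) (N M Q : nat).
Variables (L : 'M[R]_(N, M * N)) (H : 'M[R]_(Q, N)).

(** The Kronecker product of two columns of identity matrices is again one, so
    that multiplying by it selects a column of [L]. *)
Lemma next_state_delta (u : Delta R M) (x : Delta R N) :
  logical L -> next_state L (val u) (val x) \in deltas R N.
Proof.
move=> logL.
have /imageP[i _ ->] := valP u; have /imageP[j _ ->] := valP x.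
suff -> : next_state L (col i 1%:M) (col j 1%:M) = col (mxtens_index (i, j)) L.
  exact: logL.
rewrite /next_state [RHS]colE; congr (_ *m _); apply/matrixP=> k l.
case: (mxtens_indexP k) => k1 k2; rewrite [l]ord1.
rewrite !mxE !mxtens_indexK /= (can_eq (@mxtens_indexK _ _)) xpair_eqE.
by rewrite andbT -GRing.natrM mulnb.
Qed.

Lemma vertex_output (v : vertex H) (x x' : Delta R N) :
  val v = upair x x' -> H *m val x = H *m val x'.
Proof.
case/existsP: (valP v) => y /existsP[y' /andP[/eqP-> /eqP eqH]].
by case/upair_img=> -[<- <-].
Qed.

Lemma diagonal_upair (v : vertex H) (x x' : Delta R N) :
  val v = upair x x' -> diagonal v = (x == x').
Proof.
move=> ev; rewrite /diagonal ev; apply/existsP/eqP => [[y /eqP]|->].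
  by case/upair_img=> -[-> ->].
by exists x'; rewrite eqxx.
Qed.

Lemma is_vertex_upair (x x' : Delta R N) :
  H *m val x = H *m val x' -> is_vertex H (upair x x').
Proof.
by move=> eqH; apply/existsP; exists x; apply/existsP; exists x'; rewrite eqH !eqxx.
Qed.

Lemma edgeP (v w : vertex H) : reflect (exists u, u \in weight L v w) (edge L v w).
Proof. exact: set0Pn. Qed.

Lemma trans_graph_edge (v0 : vertex H) (v w : reachable L v0) :
  transition_graph (automaton L v0) v w = edge L (val v) (val w).
Proof.
apply/existsP/idP => [[u /eqP/transP[]] // | vw].
by case/edgeP: (vw) => u uvw; exists u; apply/eqP/transP.
Qed.

Lemma automaton_cycleP (v : vertex H) :
  has_cycle (transition_graph (automaton L v)) <->
  exists2 f, f 0%N = v & infinite_walk _ (edge L (H := H)) f.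
Proof.
split=> [[c [nz_c /andP[cyc_c _]]] | [f f0 ef]].
  case: c nz_c cyc_c => // z c _ cyc_c.
  apply: (reachable_cycle_walk _ _ (map val (z :: c)) _ (val z)).
  - rewrite (@cycle_map _ _ val) -(eq_cycle (e := transition_graph (automaton L v))) //.
    exact: trans_graph_edge.
  - by rewrite mem_head.
  - exact: valP.
have reach t : connect (edge L (H := H)) v (f t).
  by rewrite -f0; apply: infinite_walk_connect.
pose g t : dfa_state (automaton L v) := exist _ (f t) (reach t).
by apply: (walk_has_cycle _ _ g) => t; rewrite trans_graph_edge /=.
Qed.

Hypothesis logL : logical L.

Definition step (u : Delta R M) (x : Delta R N) : Delta R N :=
  SeqSub (next_state_delta u x logL).

Fixpoint trajectory (x : Delta R N) (U : nat -> Delta R M) (t : nat) : Delta R N :=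
  if t is t'.+1 then step (U t') (trajectory x U t') else x.

Lemma val_trajectory x U t : val (trajectory x U t) = state_at L (val x) U t.
Proof. by elim: t => //= t <-. Qed.

Lemma outputsE x U t : outputs L H (val x) U t = H *m val (trajectory x U t.+1).
Proof. by rewrite val_trajectory. Qed.

(** The network is deterministic, so the source of an edge and a letter of its
    weight determine the target. *)
Lemma weight_step (v w : vertex H) u x x' :
  val v = upair x x' ->
  (u \in weight L v w) = (val w == upair (step u x) (step u x')).
Proof.
move=> ev; have [y [y' ew]] := vertexP w.
rewrite (weightE L u ev ew) ew /drives; apply/idP/eqP.
  rewrite -[next_state L (val u) (val x)]/(val (step u x)).
  rewrite -[next_state L (val u) (val x')]/(val (step u x')).
  case/orP=> /andP[/eqP/val_inj-> /eqP/val_inj->] //.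
  exact: setUC.
by case/upair_img=> -[-> ->]; rewrite !eqxx ?orbT.
Qed.

Lemma not_observable_walk :
  ~ type4_observable L H ->
  exists f, ~~ diagonal (f 0%N) /\ infinite_walk _ (edge L (H := H)) f.
Proof.
move=> not_obs.
have [x [x' [U [ne_x eq0 eq_out]]]] : exists (x x' : Delta R N) U,
    [/\ x <> x', H *m val x = H *m val x'
      & outputs L H (val x) U = outputs L H (val x') U].
  apply: NNPP => none; apply: not_obs => x x' U ne_x eq0 eq_out.
  by apply: none; exists x, x', U.
have eqH t : H *m val (trajectory x U t) = H *m val (trajectory x' U t).
  by case: t => // t; rewrite -!outputsE eq_out.
pose f t : vertex H :=
    exist (fun v => is_vertex H v) _ (is_vertex_upair _ _ (eqH t)).
exists f; split; first by rewrite (diagonal_upair (f 0%N) x x') //; apply/eqP.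
move=> t; apply/edgeP; exists (U t).
by rewrite (weight_step _ _ _ (trajectory x U t) (trajectory x' U t)).
Qed.

Lemma walk_not_observable (f : nat -> vertex H) :
  ~~ diagonal (f 0%N) -> infinite_walk _ (edge L (H := H)) f ->
  ~ type4_observable L H.
Proof.
move=> ndiag ef obs.
have U_ex t : exists u, u \in weight L (f t) (f t.+1) by apply/edgeP.
pose U t := xchoose (U_ex t).
have UP t : U t \in weight L (f t) (f t.+1) := xchooseP (U_ex t).
have [x [x' f0]] := vertexP (f 0%N).
have fE t : val (f t) = upair (trajectory x U t) (trajectory x' U t).
  elim: t => // t IHt; apply/eqP.
  by rewrite -[_ == _](weight_step _ _ (U t) _ _ IHt).
have eqH t := vertex_output _ _ _ (fE t).
apply: (obs x x' U _ (eqH 0%N)).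
  by apply/eqP; rewrite -(diagonal_upair _ _ _ f0).
by apply: functional_extensionality => t; rewrite !outputsE.
Qed.

End Network.

Theorem mainTheorem7 (R : realFieldType) (n m q : nat)
  (n_gt0 : (0 < n)%N) (m_gt0 : (0 < m)%N) (q_gt0 : (0 < q)%N)
  (L : 'M[R]_(2 ^ n, 2 ^ m * 2 ^ n)) (H : 'M[R]_(2 ^ q, 2 ^ n))
  (logical_L : logical L) (logical_H : logical H) :
  ~ type4_observable L H <->
  exists v : vertex H,
    ~~ diagonal v /\ has_cycle (transition_graph (automaton L v)).
Proof.
split=> [not_obs | [v [ndiag]]].
  have [f [ndiag ef]] := not_observable_walk _ _ _ _ _ _ logical_L not_obs.
  by exists (f 0%N); split=> //; apply/automaton_cycleP; exists f.
case/automaton_cycleP=> f f0 ef.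
by apply: (walk_not_observable _ _ _ _ _ _ logical_L f); rewrite ?f0.
Qed.
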